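(* There exists a real-valued function $f(r,T)$ of integers $r\ge 2$ and $T\ge 1$, satisfying $f(r,T)<10(r-1)^2T^2$ for all such $r,T$, with the following property. Let $\mathcal{H}$ be a finite-dimensional complex Hilbert space and let $A_1,\ldots,A_r$ ($r\ge 2$) be positive semidefinite operators on $\mathcal{H}$. For $1\le i\le r$ let $A_i=\sum_{k=1}^{T_i}\lambda_{ik}Q_{ik}$ be the spectral decomposition of $A_i$, and let $T:=\max\{T_1,\ldots,T_r\}$. Then $$P_e^*(\{A_1,\ldots,A_r\})\le f(r,T)\sum_{(i,j):\,i<j}\ \sum_{k,\ell}\min\{\lambda_{ik},\lambda_{j\ell}\}\operatorname{Tr}Q_{ik}Q_{j\ell},$$ where the outer sum is over pairs $1\le i<j\le r$ and the inner sum is over $1\le k\le T_i$, $1\le \ell\le T_j$.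
   Context: Spectral decomposition of a Hermitian operator $X$: $X=\sum_k\lambda_kQ_k$, where the $\lambda_k$ are the pairwise distinct eigenvalues of $X$ and the $Q_k$ are the orthogonal projectors onto the corresponding eigenspaces, so $Q_kQ_l=\delta_{kl}Q_k$ and $\sum_kQ_k=\mathbb{1}$; thus $T_i$ is the number of distinct eigenvalues of $A_i$. A POVM with $r$ outcomes on $\mathcal{H}$ is a tuple $\{M_1,\ldots,M_r\}$ of operators with $0\le M_i\le\mathbb{1}$ and $\sum_{i=1}^rM_i=\mathbb{1}$. For positive semidefinite $A_1,\ldots,A_r$ (not necessarily normalized), $$P_e^*(\{A_1,\ldots,A_r\}):=\min\left\{\sum_{i=1}^r\operatorname{Tr}A_i(\mathbb{1}-M_i):\ \{M_1,\ldots,M_r\}\text{ a POVM on }\mathcal{H}\right\}.$$ *)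

(* Defs.v *)
From HB Require Import structures.
From mathcomp Require Import all_boot all_order all_algebra lra.
From mathcomp Require Import sesquilinear spectral complex.
From mathcomp Require Import boolp classical_sets functions reals topology normedtype derive.

Set Implicit Arguments.
Unset Strict Implicit.
Unset Printing Implicit Defensive.

Import Order.TTheory GRing.Theory Num.Theory Num.Def.
Import numFieldNormedType.Exports.

Local Open Scope classical_set_scope.
Local Open Scope ring_scope.
Local Open Scope sesquilinear_scope.
Local Open Scope complex_scope.

(* Operators on C^n are n x n matrices over R[i], acting on row vectors by
   v |-> v *m A, as in mxalgebra's eigenvalue and eigenspace. *)

Section Operators.
Variables (R : realType) (n : nat).
Implicit Types A B Q : 'M[R[i]]_n.

(* On R[i], 0 <= z means that z is real and nonnegative, and v^t* is the
   conjugate transpose of v. *)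
Definition psdmx A : Prop :=
  A \is hermsymmx /\ forall v : 'rV[R[i]]_n, 0 <= (v *m A *m v^t*) 0 0.

Definition loewner_le A B : Prop := psdmx (B - A).

(* Orthogonal projector onto the row space of U. *)
Definition is_orthoproj Q (m : nat) (U : 'M[R[i]]_(m, n)) : Prop :=
  [/\ Q \is hermsymmx, Q *m Q = Q & (Q :=: U)%MS].

Definition is_spectral_decomposition A (T : nat)
    (lam : 'I_T -> R) (Q : 'I_T -> 'M[R[i]]_n) : Prop :=
  [/\ injective lam,
      forall a : R[i], eigenvalue A a <-> exists k, a = (lam k)%:C,
      forall k, is_orthoproj (Q k) (eigenspace A (lam k)%:C)
    & A = \sum_(k < T) (lam k)%:C *: Q k].

Definition is_povm (r : nat) (M : 'I_r -> 'M[R[i]]_n) : Prop :=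
  (forall i, loewner_le 0 (M i) /\ loewner_le (M i) 1%:M) /\
  \sum_(i < r) M i = 1%:M.

(* The trace is real when the operators are Hermitian; complex.Re only turns it
   into an element of R. *)
Definition discrimination_error (r : nat) (A M : 'I_r -> 'M[R[i]]_n) : R :=
  complex.Re (\sum_(i < r) \tr (A i *m (1%:M - M i))).

(* The infimum is a minimum when r > 0: see min_errorP below. *)
Definition min_error (r : nat) (A : 'I_r -> 'M[R[i]]_n) : R :=
  inf [set discrimination_error A M | M in [set M | is_povm M]].

End Operators.

Lemma spectral_decomposition_exists (R : realType) (n : nat) (A : 'M[R[i]]_n) :
  A \is hermsymmx ->
  exists (T : nat) (lam : 'I_T -> R) (Q : 'I_T -> 'M[R[i]]_n),
    is_spectral_decomposition A lam Q.
Proof.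
move=> hA.
have /orthomx_spectralP EA := hermitian_normalmx hA.
have /mxOverP dr := hermitian_spectral_diag_real hA.
move: EA dr; set P := spectralmx A; set d := spectral_diag A => EA dr.
have uP : P \is unitarymx by exact: spectral_unitarymx.
rewrite (invmx_unitary uP) in EA.
have PPt : P *m P^t* = 1%:M by apply/unitarymxP.
have PtP : P^t* *m P = 1%:M by rewrite -(invmx_unitary uP) mulVmx // unitarymx_unit.
pose s := undup [seq complex.Re (d 0 i) | i <- enum 'I_n].
have us : uniq s by exact: undup_uniq.
pose lam (k : 'I_(size s)) := s`_k.
pose e (a : R[i]) : 'rV[R[i]]_n := \row_i (d 0 i == a)%:R.
pose Q a := P^t* *m diag_mx (e a) *m P.
have dR i : d 0 i = (complex.Re (d 0 i))%:C by rewrite RRe_real.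
have dlam i : exists k, d 0 i = (lam k)%:C.
  have : complex.Re (d 0 i) \in s by rewrite mem_undup; apply/mapP; exists i; rewrite ?mem_enum.
  move=> h; have h' := h; rewrite -index_mem in h'.
  by exists (Ordinal h'); rewrite /lam /= nth_index // -dR.
have lamd k : exists i, (lam k)%:C = d 0 i.
  have : lam k \in s by exact: mem_nth.
  by rewrite mem_undup => /mapP[i _ ->]; exists i; rewrite -dR.
have injlam : injective lam.
  by move=> k l /eqP; rewrite /lam nth_uniq // => /eqP /val_inj.
have eig (a : R[i]) (v : 'rV_n) : v *m A = a *: v <-> v *m Q a = v.
  pose w := v *m P^t*.
  have vw : v = w *m P by rewrite /w -mulmxA PtP mulmx1.
  have can (x y : 'rV[R[i]]_n) : x *m P = y *m P -> x = y.
    by move=> h; rewrite -[x]mulmx1 -[y]mulmx1 -PPt !mulmxA h.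
  rewrite {1}EA /Q !mulmxA -/w vw scalemxAl; split => [/can|/can] h.
    congr (_ *m P); apply/rowP => j; move/rowP/(_ j): h.
    rewrite !mul_mx_diag !mxE; case: eqVneq => [|ne]; rewrite ?mulr1 // mulr0.
    by rewrite mulrC => /eqP; rewrite -subr_eq0 -mulrBl mulf_eq0 subr_eq0 (negPf ne) => /eqP.
  congr (_ *m P); apply/rowP => j; move/rowP/(_ j): h.
  rewrite !mul_mx_diag !mxE; case: eqVneq => [->|ne]; first by move=> _; rewrite mulrC.
  by rewrite mulr0 => <-; rewrite !(mul0r, mulr0).
have QQ a : Q a *m Q a = Q a.
  rewrite /Q !mulmxA -[_ *m P *m P^t*]mulmxA PPt mulmx1 -[_ *m _ *m diag_mx _]mulmxA.
  congr (_ *m _ *m _); rewrite mulmx_diag; congr diag_mx; apply/rowP => j; rewrite !mxE.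
  by rewrite -natrM mulnb andbb.
exists (size s), lam, (fun k => Q (lam k)%:C); split => //.
- move=> a; split.
    move=> /eigenvalueP[v /eig vQ v0].
    suff [i ->] : exists i, a = d 0 i by exact: dlam.
    apply: contrapT => /forallNP h; move/eqP: v0; apply.
    rewrite -vQ /Q (_ : e a = 0) ?linear0 ?mulmx0 ?mul0mx ?mulmx0 //.
    by apply/rowP => i; rewrite !mxE; case: eqP => // /esym /h.
  case=> k ->; have [i ->] := lamd k.
  apply/eigenvalueP; exists (delta_mx 0 i *m P).
    apply/eig; rewrite /Q !mulmxA -[_ *m P *m P^t*]mulmxA PPt mulmx1.
    congr (_ *m P); apply/rowP => j; rewrite mul_mx_diag !mxE.
    by case: (eqVneq j i) => [->|]; rewrite ?eqxx ?mulr1 // !mul0r.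
  apply/eqP => /(congr1 (mulmx^~ (P^t*))); rewrite mul0mx -mulmxA PPt mulmx1.
  by move=> /rowP/(_ i); rewrite !mxE !eqxx => /eqP; rewrite oner_eq0.
- move=> k; split => //.
    apply/is_hermitianmxP; rewrite expr0 scale1r /Q !trmx_mul !map_mxM trmxCK.
    rewrite mulmxA; congr (_ *m _ *m _); rewrite tr_diag_mx map_diag_mx.
    congr diag_mx; apply/rowP => j; rewrite !mxE.
    by rewrite rmorph_nat.
  apply/eqmxP/andP; split; apply/rV_subP => v.
    by move=> /submxP[u ->]; apply/eigenspaceP/eig; rewrite -mulmxA QQ.
  by move=> /eigenspaceP/eig <-; exact: submxMl.
- rewrite {1}EA /Q.
  rewrite (_ : diag_mx d = \sum_k (lam k)%:C *: diag_mx (e (lam k)%:C)).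
    rewrite mulmx_sumr mulmx_suml; apply: eq_bigr => k _.
    by rewrite -scalemxAr -scalemxAl.
  under eq_bigr do rewrite -linearZ.
  rewrite -linear_sum; congr diag_mx; apply/rowP => j; rewrite summxE.
  have [k dk] := dlam j.
  rewrite (bigD1 k) //= big1 => [|l lk]; rewrite !mxE dk ?eqxx ?mulr1 ?addr0 //.
  case: eqP; rewrite ?mulr0 // => /(@complexI R) /injlam kl.
  by rewrite kl eqxx in lk.
Qed.

Module MinAttained.

Lemma form_pair (K : numClosedFieldType) n (M : 'M[K]_n) (j k : 'I_n) (c : K)
    (v := delta_mx 0 j + c *: delta_mx 0 k : 'rV_n) :
  (v *m M *m v^t*) 0 0 =
  M j j + c * M k j + (conjC c) * M j k + c * (conjC c) * M k k.
Proof.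
have -> : v^t* = delta_mx j 0 + (conjC c) *: delta_mx k 0.
  by rewrite linearD /= linearZ /= map_mxD map_mxZ /= !trmx_delta !map_delta_mx.
rewrite /v mulmxDl -scalemxAl -!rowE mulmxDr !mulmxDl -!scalemxAl -!scalemxAr.
rewrite -!colE !mxE.
by rewrite !addrA mulrA (mulrC (conjC c)).
Qed.

Section Povm.
Variables (R : realType) (n r : nat).
Local Notation C := R[i].

Lemma psdmx1 : psdmx (1%:M : 'M[C]_n).
Proof.
split; first exact: hermitian1mx_subproof.
move=> v; rewrite mulmx1 mxE; apply: sumr_ge0 => i _.
by rewrite !mxE mul_conjC_ge0.
Qed.

Lemma psdmx0 : psdmx (0 : 'M[C]_n).
Proof.
split; last by move=> v; rewrite mulmx0 mul0mx mxE.
by apply/is_hermitianmxP; rewrite expr0 scale1r trmx0 map_mx0.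
Qed.

Lemma povm_nonempty : (0 < r)%N -> exists M : 'I_r -> 'M[C]_n, is_povm M.
Proof.
move=> r0; pose M (i : 'I_r) : 'M[C]_n := if i == Ordinal r0 then 1%:M else 0.
exists M; split=> [i|].
  by rewrite /loewner_le subr0 /M; case: eqP => _; rewrite ?subrr ?subr0;
    split; by [exact: psdmx1 | exact: psdmx0].
rewrite (bigD1 (Ordinal r0)) //= big1 ?addr0 /M ?eqxx // => i /negPf ->.
by [].
Qed.

Lemma psdmx_diag (M : 'M[C]_n) j : psdmx M -> 0 <= M j j.
Proof.
case=> _ /(_ (delta_mx 0 j + 0 *: delta_mx 0 j)).
by rewrite form_pair !(mul0r, conjC0, addr0).
Qed.

Lemma psdmx_entry (M : 'M[C]_n) j k : psdmx M ->
  M j j <= 1 -> M k k <= 1 ->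
  `|complex.Re (M j k)| <= 1 /\ `|complex.Im (M j k)| <= 1.
Proof.
move=> [/is_hermitianmxP hM pM]; rewrite !lecE => /andP[_ dj] /andP[_ dk].
have p c := pM (delta_mx 0 j + c *: delta_mx 0 k).
have hw : M k j = conjC (M j k) by rewrite {1}hM expr0 scale1r !mxE.
have {}p c : 0 <= complex.Re (M j j + c * M k j + (conjC c) * M j k + c * (conjC c) * M k k).
  by move: (p c); rewrite form_pair lecE => /andP[].
move: (p 1) (p (-1)) (p (Complex 0 1)) (p (Complex 0 (-1))) dj dk.
rewrite hw; case: (M j k) (M j j) (M k k) => a b [d d'] [e e'] /=.
clear; rewrite !ler_norml => *; split; lra.
Qed.

Lemma povm_entry (M : 'I_r -> 'M[C]_n) i j k : is_povm M ->
  `|complex.Re (M i j k)| <= 1 /\ `|complex.Im (M i j k)| <= 1.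
Proof.
case=> /(_ i)[]; rewrite /loewner_le subr0 => pM pM1 _.
have d l : M i l l <= 1.
  by have := psdmx_diag l pM1; rewrite !mxE eqxx subr_ge0.
exact: psdmx_entry.
Qed.

End Povm.

Section Continuity.
Variables (R : realType) (N : nat).
Local Notation C := R[i].
Local Notation V := 'rV[R]_N.

Definition ccontinuous (g : V -> C) :=
  continuous (fun x => complex.Re (g x)) /\ continuous (fun x => complex.Im (g x)).

Lemma ccontinuous_cst c : ccontinuous (fun=> c).
Proof. by split; apply: cst_continuous. Qed.

Lemma ccontinuousD f g : ccontinuous f -> ccontinuous g -> ccontinuous (fun x => f x + g x).
Proof.
move=> [f1 f2] [g1 g2]; split => x.
  rewrite (_ : (fun x => _) = (fun x => complex.Re (f x) + complex.Re (g x))).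
    exact: (continuousD (f1 x) (g1 x)).
  by apply/funext => y; rewrite raddfD.
rewrite (_ : (fun x => _) = (fun x => complex.Im (f x) + complex.Im (g x))).
  exact: (continuousD (f2 x) (g2 x)).
by apply/funext => y; rewrite raddfD.
Qed.

Lemma ccontinuousM f g : ccontinuous f -> ccontinuous g -> ccontinuous (fun x => f x * g x).
Proof.
move=> [f1 f2] [g1 g2]; split => x.
  rewrite (_ : (fun x => _) = (fun x => complex.Re (f x) * complex.Re (g x) - complex.Im (f x) * complex.Im (g x))).
    exact: (continuousB (continuousM (f1 x) (g1 x)) (continuousM (f2 x) (g2 x))).
  by apply/funext => y; case: (f y) (g y) => ? ? [].
rewrite (_ : (fun x => _) = (fun x => complex.Re (f x) * complex.Im (g x) + complex.Im (f x) * complex.Re (g x))).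
  exact: (continuousD (continuousM (f1 x) (g2 x)) (continuousM (f2 x) (g1 x))).
by apply/funext => y; case: (f y) (g y) => ? ? [].
Qed.

Lemma ccontinuous_conj f : ccontinuous f -> ccontinuous (fun x => conjC (f x)).
Proof.
move=> [f1 f2]; split => x.
  rewrite (_ : (fun x => _) = (fun x => complex.Re (f x))); first exact: f1.
  by apply/funext => y; case: (f y).
rewrite (_ : (fun x => _) = (fun x => - complex.Im (f x))).
  exact: (continuousN (f2 x)).
by apply/funext => y; case: (f y).
Qed.

Lemma ccontinuous_sum (I : finType) (f : I -> V -> C) :
  (forall i, ccontinuous (f i)) -> ccontinuous (fun x => \sum_i f i x).
Proof.
move=> cf; elim: (index_enum I) => [|i s ih].
  rewrite (_ : (fun x => _) = (fun=> 0)); first exact: ccontinuous_cst.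
  by apply/funext => x; rewrite big_nil.
rewrite (_ : (fun x => _) = (fun x => f i x + \sum_(j <- s) f j x)).
  exact: ccontinuousD.
by apply/funext => x; rewrite big_cons.
Qed.

Lemma closed_cge0 g : ccontinuous g -> closed [set x | 0 <= g x].
Proof.
move=> [g1 g2].
rewrite (_ : [set x | _] = ((fun x => complex.Im (g x)) @^-1` [set 0 : R])
   `&` ((fun x => complex.Re (g x)) @^-1` [set y : R | 0 <= y])).
  apply: closedI; apply: closed_comp.
  - by move=> x _; exact: g2.
  - exact: closed_eq.
  - by move=> x _; exact: g1.
  - exact: closed_ge.
apply/seteqP; split=> x /=; rewrite lecE /=.
  by move=> /andP[/eqP].
by move=> [-> ->]; rewrite eqxx.
Qed.

Lemma closed_ceq g c : ccontinuous g -> closed [set x | g x = c].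
Proof.
move=> [g1 g2].
rewrite (_ : [set x | _] = ((fun x => complex.Im (g x)) @^-1` [set complex.Im c])
   `&` ((fun x => complex.Re (g x)) @^-1` [set complex.Re c])).
  apply: closedI; apply: closed_comp.
  - by move=> x _; exact: g2.
  - exact: closed_eq.
  - by move=> x _; exact: g1.
  - exact: closed_eq.
apply/seteqP; split=> x /=; first by move=> ->.
by case: (g x) c => ? ? [? ?] /= [-> ->].
Qed.
End Continuity.

Section Attained.
Variables (R : realType) (n r : nat).
Local Notation C := R[i].
Local Notation I := ('I_r * 'I_n * 'I_n * bool)%type.
Local Notation V := 'rV[R]_#|{: I}|.

Definition povm_of (x : V) (i : 'I_r) : 'M[C]_n :=
  \matrix_(j, k) Complex (x ord0 (enum_rank (i, j, k, true)))
                         (x ord0 (enum_rank (i, j, k, false))).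

Lemma povm_of_surj (M : 'I_r -> 'M[C]_n) :
  exists x : V, povm_of x = M.
Proof.
exists (\row_s let: (i, j, k, b) := enum_val s in
   if b then complex.Re (M i j k) else complex.Im (M i j k)).
apply/funext => i; apply/matrixP => j k; rewrite !mxE !enum_rankK.
by case: (M i j k).
Qed.

Lemma ccontinuous_povm i j k : ccontinuous (fun x => povm_of x i j k).
Proof.
split.
  rewrite (_ : (fun x => _) = fun x : V => x ord0 (enum_rank (i, j, k, true))).
    exact: coord_continuous.
  by apply/funext => x; rewrite mxE.
rewrite (_ : (fun x => _) = fun x : V => x ord0 (enum_rank (i, j, k, false))).
  exact: coord_continuous.
by apply/funext => x; rewrite mxE.
Qed.

Definition mcontinuous m p (F : V -> 'M[C]_(m, p)) :=
  forall j k, ccontinuous (fun x => F x j k).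

Lemma mcontinuous_cst m p (B : 'M[C]_(m, p)) : mcontinuous (fun=> B).
Proof. by move=> j k; exact: ccontinuous_cst. Qed.

Lemma mcontinuousD m p (F G : V -> 'M[C]_(m, p)) :
  mcontinuous F -> mcontinuous G -> mcontinuous (fun x => F x + G x).
Proof.
move=> cF cG j k.
rewrite (_ : (fun x => _) = fun x => F x j k + G x j k); first exact: ccontinuousD.
by apply/funext => x; rewrite mxE.
Qed.

Lemma mcontinuousM m p q (F : V -> 'M[C]_(m, p)) (G : V -> 'M[C]_(p, q)) :
  mcontinuous F -> mcontinuous G -> mcontinuous (fun x => F x *m G x).
Proof.
move=> cF cG j k.
rewrite (_ : (fun x => _) = fun x => \sum_l F x j l * G x l k).
  by apply: ccontinuous_sum => l; exact: ccontinuousM.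
by apply/funext => x; rewrite mxE.
Qed.

Lemma mcontinuousN m p (F : V -> 'M[C]_(m, p)) :
  mcontinuous F -> mcontinuous (fun x => - F x).
Proof.
move=> cF j k.
rewrite (_ : (fun x => _) = fun x => (-1) * F x j k).
  by apply: ccontinuousM => //; exact: ccontinuous_cst.
by apply/funext => x; rewrite mxE mulN1r.
Qed.

Lemma mcontinuous_povm i : mcontinuous (fun x => povm_of x i).
Proof. by move=> j k; exact: ccontinuous_povm. Qed.

Lemma closed_psd (F : V -> 'M[C]_n) :
  mcontinuous F -> closed [set x | psdmx (F x)].
Proof.
move=> cF; rewrite (_ : [set x | _] =
  (\bigcap_(jk in @setT ('I_n * 'I_n)) [set x | F x jk.1 jk.2 - conjC (F x jk.2 jk.1) = 0])
  `&` \bigcap_(v in @setT 'rV[C]_n) [set x | 0 <= (v *m F x *m v^t*) 0 0]).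
  apply: closedI; apply: closed_bigI => t _.
    rewrite (_ : [set x | _] = [set x | F x t.1 t.2 + (-1) * conjC (F x t.2 t.1) = 0]).
      apply: closed_ceq; apply: ccontinuousD => //; apply: ccontinuousM; first exact: ccontinuous_cst.
      exact: ccontinuous_conj.
    by apply/seteqP; split => x /=; rewrite mulN1r.
  apply: closed_cge0.
  exact: (mcontinuousM (mcontinuousM (mcontinuous_cst _) cF) (mcontinuous_cst _)).
apply/seteqP; split=> x /=.
  move=> [/is_hermitianmxP h p]; split=> [[j k] _|v _] /=; last exact: p.
  by rewrite {1}h expr0 scale1r !mxE subrr.
move=> [h p]; split; last by move=> v; exact: p.
apply/is_hermitianmxP; rewrite expr0 scale1r; apply/matrixP => j k; rewrite !mxE.
by apply/eqP; rewrite -subr_eq0; apply/eqP; exact: (h (j, k)).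
Qed.

Lemma closed_povm : closed [set x | is_povm (povm_of x)].
Proof.
rewrite (_ : [set x | _] =
  (\bigcap_(i in @setT 'I_r) ([set x | psdmx (povm_of x i + - 0)] `&`
      [set x | psdmx (1%:M + - povm_of x i)]))
  `&` \bigcap_(jk in @setT ('I_n * 'I_n))
     [set x | \sum_i povm_of x i jk.1 jk.2 = (1%:M : 'M[C]_n) jk.1 jk.2]).
  apply: closedI; apply: closed_bigI => t _.
    apply: closedI; apply: closed_psd; apply: mcontinuousD.
    - exact: mcontinuous_povm.
    - exact: mcontinuous_cst.
    - exact: mcontinuous_cst.
    - exact/mcontinuousN/mcontinuous_povm.
  by apply: closed_ceq; apply: ccontinuous_sum => i; exact: ccontinuous_povm.
apply/seteqP; split=> x /=.
  move=> [p s]; split=> [i _|[j k] _] /=; first by have [] := p i.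
  by rewrite -s summxE.
move=> [p s]; split=> [i|]; first by have [] := p i Logic.I.
by apply/matrixP => j k; rewrite summxE; exact: (s (j, k)).
Qed.

Lemma compact_povm : compact [set x | is_povm (povm_of x)].
Proof.
pose K := [set v : V | forall s, `[-1, 1]%classic (v ord0 s)].
have cK : compact K.
  have /rV_compact : forall s : 'I_#|{: I}|, compact (`[-1, 1]%classic : set R).
    by move=> s; exact: segment_compact.
  by [].
rewrite (_ : [set x | _] = K `&` [set x | is_povm (povm_of x)]).
  exact: compact_closedI cK closed_povm.
apply/seteqP; split => x /=; last by case.
move=> p; split=> // s; rewrite /= in_itv /= -ler_norml.
case E : (enum_val s) => [[[i j] k] b].
have [h1 h2] := povm_entry i j k p.
move: h1 h2; rewrite !mxE /=.
have -> : s = enum_rank (i, j, k, b) by rewrite -E enum_valK.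
by case: b {E}.
Qed.

Lemma continuous_error (A : 'I_r -> 'M[C]_n) :
  continuous (fun x => discrimination_error A (povm_of x)).
Proof.
have [//] : ccontinuous (fun x => \sum_i \tr (A i *m (1%:M + - povm_of x i))).
apply: ccontinuous_sum => i; apply: ccontinuous_sum => j.
exact: (mcontinuousM (mcontinuous_cst _) (mcontinuousD (mcontinuous_cst _) (mcontinuousN (@mcontinuous_povm i)))).
Qed.

End Attained.

End MinAttained.

Section MinError.
Import MinAttained.

Lemma min_errorP (R : realType) (n r : nat) (A : 'I_r -> 'M[R[i]]_n) :
  (0 < r)%N ->
  (exists2 M, is_povm M & discrimination_error A M = min_error A) /\
  (forall M, is_povm M -> min_error A <= discrimination_error A M).
Proof.
move=> r0; have [M0 pM0] := povm_nonempty R n r0.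
have [x0 x0M] := povm_of_surj M0.
have ne : [set x | is_povm (@povm_of R n r x)] !=set0 by exists x0; rewrite /= x0M.
have [x] := EVT_min_rV ne (@compact_povm R n r)
  (continuous_subspaceT (@continuous_error R n r A)).
rewrite inE /= => px minx.
have lb M : is_povm M -> discrimination_error A (povm_of x) <= discrimination_error A M.
  by have [y <-] := povm_of_surj M => py; apply: minx; rewrite inE.
have E : discrimination_error A (povm_of x) = min_error A.
  apply/eqP; rewrite eq_le; apply/andP; split.
    apply: lb_le_inf; first by exists (discrimination_error A M0), M0.
    by move=> _ [M pM <-]; exact: lb.
  apply: ge_inf; last by exists (povm_of x).
  by exists (discrimination_error A (povm_of x)) => _ [M pM <-]; exact: lb.
split; first by exists (povm_of x).
by rewrite -E.
Qed.

End MinError.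

(* Main.v *)
(* Order the spectral projectors P_m of all the A_i by decreasing eigenvalue and
   label each by its operator; put K = (r-1)T and s = 1/(2K).  Going down the list,
   shrink P_m to Q_m <= P_m by cutting the spectral subspace where P_m S P_m > s^2,
   S being the sum of the earlier Q_l with another label; Markov's inequality bounds
   the lost trace by 4K^2 tr(P_m S).  The surviving Q_m are nearly orthogonal, each
   being non-orthogonal to at most K others, so G = sum_(l < m) Q_l has no eigenvalue
   in (0,1/2), and its support projector U_m satisfies U_m <= 2G.  The Gram-Schmidt
   projectors E_m = U_(m+1) - U_m form a measurement, with tr(Q_m(1 - E_m)) =
   tr(Q_m U_m) <= 2 tr(Q_m G): only earlier l contribute, for which the eigenvalue of
   P_m is the smaller one.  Altogether f = 4K^2 + 2 < 10K^2. *)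

Require Import Defs.
From mathcomp Require Import all_boot all_order all_algebra.
From mathcomp Require Import sesquilinear spectral complex.
From mathcomp Require Import reals.

Set Implicit Arguments.
Unset Strict Implicit.
Unset Printing Implicit Defensive.

Import Order.TTheory GRing.Theory Num.Theory.

Local Open Scope ring_scope.
Local Open Scope complex_scope.

(** * Adjoints, positive semidefinite matrices and projectors *)

Section Psd.
Import Num.Def.
Local Open Scope sesquilinear_scope.
Variable C : numClosedFieldType.

Lemma adjmxM m n p (A : 'M[C]_(m, n)) (B : 'M[C]_(n, p)) :
  (A *m B)^t* = B^t* *m A^t*.
Proof. by rewrite trmx_mul map_mxM. Qed.

Lemma adjmxD m n (A B : 'M[C]_(m, n)) : (A + B)^t* = A^t* + B^t*.
Proof. by rewrite linearD /= map_mxD. Qed.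

Lemma adjmxB m n (A B : 'M[C]_(m, n)) : (A - B)^t* = A^t* - B^t*.
Proof. by rewrite linearB /= map_mxB. Qed.

Lemma adjmxZ m n a (A : 'M[C]_(m, n)) : (a *: A)^t* = (conjC a) *: A^t*.
Proof. by rewrite linearZ /= map_mxZ. Qed.

Lemma adjmx0 m n : (0 : 'M[C]_(m, n))^t* = 0.
Proof. by rewrite trmx0 map_mx0. Qed.

Lemma adjmx1 n : (1%:M : 'M[C]_n)^t* = 1%:M.
Proof. by rewrite trmx1 map_mx1. Qed.

Lemma mxtrace_gram_ge0 m n (B : 'M[C]_(m, n)) : 0 <= \tr (B *m B^t*).
Proof.
apply: sumr_ge0 => i _; rewrite mxE; apply: sumr_ge0 => j _.
by rewrite !mxE mul_conjC_ge0.
Qed.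

Lemma mxtrace_gram_eq0 m n (B : 'M[C]_(m, n)) : \tr (B *m B^t*) = 0 -> B = 0.
Proof.
have h i j : 0 <= B i j * B^t* j i by rewrite !mxE mul_conjC_ge0.
move=> /psumr_eq0P h0; apply/matrixP => i j; rewrite [RHS]mxE.
have /psumr_eq0P : \sum_j B i j * B^t* j i = 0.
  by rewrite -[RHS](h0 _ i) ?mxE // => k _; rewrite mxE sumr_ge0.
move=> /(_ (fun k _ => h i k) j isT) /eqP; rewrite !mxE mul_conjC_eq0.
by move/eqP.
Qed.

Section Square.
Variable n : nat.
Implicit Types A B Q : 'M[C]_n.

(** The notion of [psdmx] over any closed numeric field, with self-adjointness as a rewritable
    equation; [psdmxE] links the two. *)
Definition psd A := A^t* = A /\ forall v : 'rV[C]_n, 0 <= (v *m A *m v^t*) 0 0.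

Lemma psd0 : psd 0.
Proof. by split=> [|v]; rewrite ?adjmx0 // mulmx0 mul0mx mxE. Qed.

Lemma psd1 : psd 1%:M.
Proof.
split=> [|v]; first exact: adjmx1.
by rewrite mulmx1 -trace_mx11 mxtrace_gram_ge0.
Qed.

Lemma psdD A B : psd A -> psd B -> psd (A + B).
Proof.
move=> [hA pA] [hB pB]; split.
  by rewrite adjmxD hA hB.
by move=> v; rewrite mulmxDr mulmxDl mxE addr_ge0.
Qed.

Lemma psdZ a A : 0 <= a -> psd A -> psd (a *: A).
Proof.
move=> a0 [hA pA]; split.
  by rewrite adjmxZ hA (CrealP _) // ger0_real.
by move=> v; rewrite -scalemxAr -scalemxAl mxE mulr_ge0.
Qed.

Lemma psd_sum (I : Type) (s : seq I) (p : pred I) (A : I -> 'M[C]_n) :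
  (forall i, p i -> psd (A i)) -> psd (\sum_(i <- s | p i) A i).
Proof.
move=> h; apply: (big_ind (fun X => psd X)) => //; last exact: psdD.
exact: psd0.
Qed.

Lemma psd_conj B A : psd A -> psd (B *m A *m B^t*).
Proof.
move=> [hA pA]; split.
  by rewrite !adjmxM trmxCK hA mulmxA.
by move=> v; have := pA (v *m B); rewrite adjmxM !mulmxA.
Qed.

Lemma psd_trace A : psd A -> 0 <= \tr A.
Proof.
move=> [_ p]; apply: sumr_ge0 => i _; have := p (delta_mx 0 i).
by rewrite trmx_delta map_delta_mx -rowE -colE !mxE.
Qed.

Definition is_proj Q := Q^t* = Q /\ Q *m Q = Q.

Lemma is_proj_psd Q : is_proj Q -> psd Q.
Proof.
move=> [hQ QQ]; rewrite -QQ -[X in X *m _]mulmx1 -[X in _ *m X]hQ.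
exact/psd_conj/psd1.
Qed.

(** By cyclicity the trace is that of QAQ, which is positive semidefinite. *)
Lemma psd_trace_proj A Q : psd A -> is_proj Q -> 0 <= \tr (Q *m A).
Proof.
move=> pA [hQ QQ]; rewrite -QQ -mulmxA mxtrace_mulC -{2}hQ.
exact/psd_trace/psd_conj.
Qed.

Lemma psd_trace_proj_le A B Q :
  psd (B - A) -> is_proj Q -> \tr (Q *m A) <= \tr (Q *m B).
Proof.
by move=> p q; rewrite -subr_ge0 -linearB -mulmxBr; exact: psd_trace_proj.
Qed.

(** [P *m Q = Q] encodes Q <= P throughout; its adjoint gives [Q *m P = Q]. *)
Lemma is_proj_sub P Q : is_proj P -> is_proj Q -> P *m Q = Q -> is_proj (P - Q).
Proof.
move=> [hP PP] [hQ QQ] PQ; have QP : Q *m P = Q by rewrite -hP -[in LHS]hQ -adjmxM PQ.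
split; first by rewrite adjmxB hP hQ.
by rewrite mulmxBl !mulmxBr PP PQ QP QQ subrr subr0.
Qed.

(** * Functional calculus of a Hermitian matrix *)

Section Fcalc.
Variable A : 'M[C]_n.
Hypothesis hA : A^t* = A.
Local Notation U := (spectralmx A).
Local Notation d := (spectral_diag A).
Implicit Types g h : C -> C.

(** For Hermitian [A] this is g(A), the rows of [U] being an orthonormal eigenbasis. *)
Definition fcalc g : 'M[C]_n := U^t* *m diag_mx (map_mx g d) *m U.

Lemma spectralmx_mulV : U *m U^t* = 1%:M.
Proof. exact/unitarymxP/spectral_unitarymx. Qed.

Lemma eq_fcalc g h : (forall i, g (d 0 i) = h (d 0 i)) -> fcalc g = fcalc h.
Proof.
by move=> E; rewrite /fcalc; congr (_ *m diag_mx _ *m _); apply/rowP => i; rewrite !mxE.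
Qed.

Lemma fcalcM g h : fcalc g *m fcalc h = fcalc (fun x => g x * h x).
Proof.
rewrite /fcalc !mulmxA -[_ *m U *m U^t*]mulmxA spectralmx_mulV mulmx1.
rewrite -[_ *m _ *m diag_mx _]mulmxA mulmx_diag.
by congr (_ *m diag_mx _ *m _); apply/rowP => i; rewrite !mxE.
Qed.

Lemma fcalcB g h : fcalc g - fcalc h = fcalc (fun x => g x - h x).
Proof.
rewrite /fcalc -mulmxBl -mulmxBr -linearB.
by congr (_ *m diag_mx _ *m _); apply/rowP => i; rewrite !mxE.
Qed.

Lemma fcalcZ a g : a *: fcalc g = fcalc (fun x => a * g x).
Proof.
rewrite /fcalc scalemxAl scalemxAr -linearZ /=.
by congr (_ *m diag_mx _ *m _); apply/rowP => i; rewrite !mxE.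
Qed.

Lemma fcalc_cst a : fcalc (fun=> a) = a%:M.
Proof.
rewrite /fcalc (_ : diag_mx _ = a%:M).
  rewrite mul_mx_scalar -scalemxAl -(invmx_unitary (spectral_unitarymx _)).
  by rewrite mulVmx ?spectral_unit // scalemx1.
by rewrite -diag_const_mx; congr diag_mx; apply/rowP => i; rewrite !mxE.
Qed.

Let symA : A \is hermsymmx.
Proof. by apply/is_hermitianmxP; rewrite expr0 scale1r hA. Qed.

Lemma fcalc_id : fcalc id = A.
Proof.
have /hermitian_normalmx/orthomx_spectralP EA := symA.
rewrite [RHS]EA (invmx_unitary (spectral_unitarymx _)) /fcalc.
by congr (_ *m diag_mx _ *m _); apply/rowP => i; rewrite !mxE.
Qed.

Lemma spectral_diag_real i : d 0 i \is Num.real.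
Proof. by have /hermitian_spectral_diag_real/mxOverP := symA. Qed.

Lemma fcalc_herm g : (forall i, g (d 0 i) \is Num.real) -> (fcalc g)^t* = fcalc g.
Proof.
move=> gR; rewrite /fcalc !adjmxM trmxCK mulmxA tr_diag_mx map_diag_mx.
by congr (_ *m diag_mx _ *m _); apply/rowP => i; rewrite !mxE; apply/CrealP.
Qed.

(** Testing on the i-th row of [U] isolates [g (d 0 i)]; conversely the form at v is the sum of the
    g(d_i)|w_i|^2, where w holds the coordinates of v in the eigenbasis. *)
Lemma fcalc_psdP g : psd (fcalc g) <-> forall i, 0 <= g (d 0 i).
Proof.
split=> [[_ p] i|g0].
  have := p (delta_mx 0 i *m U); rewrite /fcalc adjmxM !mulmxA.
  rewrite -[_ *m U *m U^t*]mulmxA spectralmx_mulV mulmx1.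
  rewrite -[_ *m U *m U^t*]mulmxA spectralmx_mulV mulmx1.
  rewrite mul_mx_diag mxE (bigD1 i) //= big1 => [|j ji]; rewrite !mxE ?eqxx.
    by rewrite conjC1 mul1r mulr1 addr0.
  by rewrite (negPf ji) andbF !mul0r.
split; first by apply: fcalc_herm => i; exact: ger0_real.
move=> v; rewrite /fcalc !mulmxA -(mulmxA _ U) -[U in U *m v^t*]trmxCK -adjmxM.
rewrite mul_mx_diag mxE; apply: sumr_ge0 => i _; rewrite [X in X * _]mxE 2!mxE.
by rewrite -mulrA mulrC !mxE -mulrA [_^* * _]mulrC mulr_ge0 ?mul_conjC_ge0.
Qed.

Lemma spectral_diag_ge0 i : psd A -> 0 <= d 0 i.
Proof. by rewrite -{1}fcalc_id => /fcalc_psdP. Qed.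

Lemma fcalc_is_proj (p : pred C) : is_proj (fcalc (fun x => (p x)%:R)).
Proof.
split; first by apply: fcalc_herm => i; rewrite realn.
by rewrite fcalcM; apply: eq_fcalc => i; rewrite -natrM mulnb andbb.
Qed.

End Fcalc.
Arguments fcalc_id {A} hA.
Arguments spectral_diag_ge0 {A} hA i.
Arguments spectral_diag_real {A} hA i.

(** With B = PSP and X the spectral projector of B for the eigenvalues above e, the witness is Q = P
    - X. *)
Lemma proj_threshold P S (e : C) : is_proj P -> psd S -> 0 < e ->
  exists Q, [/\ is_proj Q, P *m Q = Q, psd (e *: Q - Q *m S *m Q)
              & e * \tr (P - Q) <= \tr (P *m S)].
Proof.
move=> pP pS e0; have [hP PP] := pP; pose B := P *m S *m P.
have pB : psd B by rewrite /B -[X in _ *m X]hP; exact: psd_conj.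
have hB : B^t* = B by case: pB.
have d0 i : 0 <= spectral_diag B 0 i by exact: spectral_diag_ge0.
pose X := fcalc B (fun x => (e < x)%R%:R).
have pX : is_proj X by exact: fcalc_is_proj.
have BE : fcalc B id = B by exact: fcalc_id.
have PX : P *m X = X.
  (* On the range of [X] the eigenvalues exceed e > 0 and can be inverted, so [X] factors through
     [B] and inherits PB = B. *)
  have -> : X = B *m fcalc B (fun x => (e < x)%R%:R / x).
    rewrite -{1}BE fcalcM; apply: eq_fcalc => i.
    case h: (e < _); last by rewrite mul0r mulr0.
    by rewrite mulrCA divff ?mulr1 // gt_eqF // (lt_trans e0).
  by rewrite !mulmxA PP.
have XP : X *m P = X by have [hX _] := pX; rewrite -hP -[in LHS]hX -adjmxM PX.
exists (P - X); split.
- exact: is_proj_sub.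
- by rewrite mulmxBr PP PX.
(* Since Q = P(1 - X) and X commutes with B, QSQ = B(1 - X); the function (e - x)(1 - [e < x]) is
   nonnegative. *)
- have -> : e *: (P - X) - (P - X) *m S *m (P - X) =
      P *m fcalc B (fun x => (e - x) * (1 - (e < x)%R%:R)) *m P^t*.
    have -> : fcalc B (fun x => (e - x) * (1 - (e < x)%R%:R)) =
        (e%:M - B) *m (1%:M - X).
      by rewrite -[in RHS]BE -!(fcalc_cst B) !fcalcB fcalcM.
    have BP : B *m P = B by rewrite /B -!mulmxA PP.
    have PB : P *m B = B by rewrite /B !mulmxA PP.
    have XB : X *m B = B *m X.
      by rewrite -BE /X !fcalcM; apply: eq_fcalc => i; rewrite mulrC.
    have -> : (P - X) *m S *m (P - X) = B - B *m X.
      have h1 : P - X = (1%:M - X) *m P by rewrite mulmxBl mul1mx XP.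
      have h2 : P - X = P *m (1%:M - X) by rewrite mulmxBr mulmx1 PX.
      transitivity ((1%:M - X) *m B *m (1%:M - X)).
        by rewrite {1}h1 h2 /B !mulmxA.
      rewrite mulmxBl mul1mx XB mulmxBr mulmx1 mulmxBl -(mulmxA B X X).
      by have [_ ->] := pX; rewrite subrr subr0.
    rewrite mulmxBl mul_scalar_mx [B *m (_ - _)]mulmxBr mulmx1 hP.
    rewrite mulmxBr mulmxBl -scalemxAr -scalemxAl [P *m (_ - X)]mulmxBr mulmx1 PX.
    by rewrite mulmxBl PP XP mulmxBr mulmxA PB mulmxBl BP -(mulmxA B) XP.
  apply: psd_conj; apply/fcalc_psdP => i.
  have [h|h] := real_ltP (gtr0_real e0) (spectral_diag_real hB i).
    by rewrite subrr mulr0.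
  by rewrite subr0 mulr1 subr_ge0.
(* Markov's inequality: eX <= B because the eigenvalues of [B] are nonnegative, and Tr B = Tr PS. *)
- rewrite opprB addrC subrK.
  have -> : \tr (P *m S) = \tr B by rewrite [in RHS]mxtrace_mulC mulmxA PP.
  rewrite -linearZ -subr_ge0 -linearB; apply: psd_trace.
  rewrite /= -{1}BE fcalcZ fcalcB; apply/fcalc_psdP => i.
  have [h|h] := real_ltP (gtr0_real e0) (spectral_diag_real hB i).
    by rewrite mulr1 subr_ge0 ltW.
  by rewrite mulr0 subr0.
Qed.

(** * Support projectors and cross terms *)

Definition suppmx A := fcalc A (fun x => (x != 0)%:R).

Section Support.
Variable A : 'M[C]_n.
Hypothesis pA : psd A.

Let hA : A^t* = A. Proof. by case: pA. Qed.

Lemma suppmx_is_proj : is_proj (suppmx A).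
Proof. exact: (fcalc_is_proj A (fun x => x != 0)). Qed.

Lemma suppmx_mul : suppmx A *m A = A.
Proof.
rewrite -[in RHS](fcalc_id hA) -{2}(fcalc_id hA) fcalcM; apply: eq_fcalc => i.
by case: eqP => [->|_]; rewrite ?mulr0 ?mul1r.
Qed.

(** The witness inverts [A] on its support. A matrix that fixes [A] from the left therefore fixes
    [suppmx A]. *)
Lemma suppmx_range : exists B, suppmx A = A *m B.
Proof.
exists (fcalc A (fun x => x^-1)); rewrite -{2}(fcalc_id hA) fcalcM.
by apply: eq_fcalc => i; case: eqVneq => [->|?]; rewrite ?mul0r ?divff.
Qed.

(* For a > 0 the hypothesis says that A has no eigenvalue strictly between 0 and 1/a. *)
Lemma suppmx_le a : psd (a *: (A *m A) - A) -> psd (a *: A - suppmx A).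
Proof.
have d0 i : 0 <= spectral_diag A 0 i by exact: spectral_diag_ge0.
rewrite -[in X in X -> _](fcalc_id hA) fcalcM fcalcZ fcalcB => /fcalc_psdP h.
rewrite -[X in psd (_ *: X - _)](fcalc_id hA) fcalcZ fcalcB.
apply/fcalc_psdP => i; have [->|ne] := eqVneq (spectral_diag A 0 i) 0.
  by rewrite mulr0 subr0.
have := h i; set x := spectral_diag A 0 i.
rewrite -{3}[x]mul1r mulrA -mulrBl pmulr_lge0 //.
by rewrite lt_neqAle eq_sym ne d0.
Qed.

End Support.

(** With B' the adjoint of B, the nonnegative traces of the B Q_i B' add up to zero, so each B Q_i
    has zero Hilbert-Schmidt norm. *)
Lemma psd_sum_ker (I : finType) (p : pred I) (Q : I -> 'M[C]_n) B :
  (forall i, is_proj (Q i)) -> B *m (\sum_(i | p i) Q i) = 0 ->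
  forall i, p i -> B *m Q i = 0.
Proof.
move=> pQ B0 i pi.
have E j : B *m Q j *m (B *m Q j)^t* = B *m Q j *m B^t*.
  by have [hQ QQ] := pQ j; rewrite adjmxM hQ mulmxA -(mulmxA B) QQ.
apply: mxtrace_gram_eq0.
have /psumr_eq0P : \sum_(j | p j) \tr (B *m Q j *m (B *m Q j)^t*) = 0.
  under eq_bigr do rewrite E.
  by rewrite -linear_sum -mulmx_suml -mulmx_sumr B0 mul0mx linear0.
by apply=> // j _; exact: mxtrace_gram_ge0.
Qed.

Lemma psd_cross (s : C) P Q : is_proj P -> is_proj Q -> 0 < s ->
  psd (s ^+ 2 *: Q - Q *m P *m Q) ->
  psd (s *: (P + Q) + (P *m Q + Q *m P)).
Proof.
move=> [hP PP] [hQ QQ] s0 h; have sr : conjC s = s by apply/CrealP; exact: gtr0_real.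
have sne : s != 0 by rewrite gt_eqF.
(* (sP + QP)(sP + QP)^* = s^2 P + s(PQ + QP) + QPQ, and QPQ <= s^2 Q. *)
have := psd_conj (s *: P + Q *m P) psd1.
rewrite mulmx1 adjmxD adjmxZ sr adjmxM hP hQ => /psdD/(_ h).
move/(@psdZ s^-1); rewrite invr_ge0 ltW // => /(_ isT).
congr psd; rewrite mulmxDl !mulmxDr -!scalemxAl -!scalemxAr PP.
rewrite !mulmxA -[Q *m P *m P]mulmxA PP -!addrA [Q *m P *m Q + _]addrC subrK.
rewrite !scalerDr !scalerA mulVf // !scale1r expr2 mulrA mulVf // mul1r.
by rewrite -[RHS]addrA [s *: Q + _]addrC !addrA.
Qed.

(** * Pruning and the Gram-Schmidt measurement *)

Section Core.
Variables (N : nat) (L : eqType) (c : 'I_N -> L) (P : 'I_N -> 'M[C]_n).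
Hypothesis projP : forall m, is_proj (P m).
Hypothesis orthP : forall l m : 'I_N, l != m -> c l = c m -> P l *m P m = 0.

(** Recursion along the list: [proj_threshold] is applied to [P m] and the sum of the earlier [Q l],
    already fixed at that stage. *)
Lemma pruned_projectors (e : C) : 0 < e -> exists Q : 'I_N -> 'M[C]_n, forall m : 'I_N,
  let S := \sum_(l : 'I_N | (l < m)%N && (c l != c m)) Q l in
  [/\ is_proj (Q m), P m *m Q m = Q m, psd (e *: Q m - Q m *m S *m Q m)
    & e * \tr (P m - Q m) <= \tr (P m *m S)].
Proof.
move=> e0; pose S (Q : 'I_N -> 'M[C]_n) (m : 'I_N) : 'M[C]_n :=
  \sum_(l : 'I_N | (l < m)%N && (c l != c m)) Q l.
suff /(_ N) [Q hQ] : forall k, exists Q : 'I_N -> 'M[C]_n, forall m : 'I_N, (m < k)%N ->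
    [/\ is_proj (Q m), P m *m Q m = Q m, psd (e *: Q m - Q m *m S Q m *m Q m)
      & e * \tr (P m - Q m) <= \tr (P m *m S Q m)].
  by exists Q => m; exact: hQ.
elim=> [|k [Q hQ]]; first by exists P.
have [kN|Nk] := ltnP k N; last first.
  by exists Q => m _; apply: hQ; exact: leq_trans (ltn_ord m) Nk.
pose mk := Ordinal kN.
have pS : psd (S Q mk).
  by apply: psd_sum => l /andP[lk _]; apply: is_proj_psd; have [] := hQ l lk.
have [X hX] := proj_threshold (projP mk) pS e0.
pose Q' m := if m == mk then X else Q m.
(* Redefining [Q] at [k] changes no sum for m <= k, as these run over l < m only. *)
have SE (m : 'I_N) : (m <= k)%N -> S Q' m = S Q m.
  move=> mk'; apply: eq_bigr => l /andP[lm _]; rewrite /Q'; case: eqP => // lE.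
  by move: (leq_trans lm mk'); rewrite lE ltnn.
exists Q' => m; rewrite ltnS => mlek; rewrite SE // /Q'.
case: eqP => [->//|/eqP ne]; apply: hQ.
by rewrite ltn_neqAle mlek andbT.
Qed.

Variable K : nat.
Hypothesis K_gt0 : (0 < K)%N.
Hypothesis degK : forall m, (#|[pred l | c l != c m]| <= K)%N.
Let s : C := (2 * K)%:R^-1.

Let s_gt0 : 0 < s. Proof. by rewrite invr_gt0 ltr0n muln_gt0. Qed.

Section Gram.
Variable Q : 'I_N -> 'M[C]_n.
Hypothesis projQ : forall m, is_proj (Q m).
Hypothesis orthQ : forall l m : 'I_N, l != m -> c l = c m -> Q l *m Q m = 0.
Hypothesis crossQ : forall l m : 'I_N, (l < m)%N -> c l != c m ->
  psd (s ^+ 2 *: Q m - Q m *m Q l *m Q m).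

(** G^2 = G + H, with H the sum of the [Q l *m Q m] over different labels. Summing [psd_cross] over
    ordered pairs gives 2H >= -2sD, where D counts each [Q l] once per partner, so D <= KG. As 2sK =
    1, it follows that 2G^2 - G = G + 2H >= 0. *)
Lemma gram_gap (p : pred 'I_N) (G := \sum_(l | p l) Q l) :
  psd (2%:R *: (G *m G) - G).
Proof.
pose q l m := p m && (c l != c m).
have qsym l m : p l && q l m = p m && q m l.
  by rewrite /q eq_sym; case: (p l); rewrite ?andbF.
pose X := \sum_(l | p l) \sum_(m | q l m) (s *: (Q l + Q m) + (Q l *m Q m + Q m *m Q l)).
have pX : psd X.
  apply: psd_sum => l _; apply: psd_sum => m /andP[_ clm].
  have [lm|ml|/val_inj lm] := ltngtP l m; last by rewrite lm eqxx in clm.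
    exact/psd_cross/crossQ.
  (* [crossQ] speaks of l < m only; the summand is symmetric, so this case is swapped. *)
  rewrite [Q l + _]addrC [Q l *m _ + _]addrC.
  by apply/psd_cross/crossQ => //; rewrite eq_sym.
pose D := \sum_(l | p l) \sum_(m | q l m) Q l.
pose H := \sum_(l | p l) \sum_(m | q l m) Q l *m Q m.
have swap (F : 'I_N -> 'I_N -> 'M[C]_n) :
    \sum_(l | p l) \sum_(m | q l m) F m l = \sum_(l | p l) \sum_(m | q l m) F l m.
  rewrite [LHS](exchange_big_dep p) => [|l m pl /andP[]//] /=.
  apply: eq_bigr => l pl; apply: eq_bigl => m.
  by have := qsym m l; rewrite pl /= => ->.
have XE : X = s *: (D + D) + (H + H).
  rewrite /X; under eq_bigr do rewrite big_split -scaler_sumr big_split big_split /=.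
  rewrite big_split -scaler_sumr !big_split /=; congr (_ *: (_ + _) + (_ + _)).
    exact: (swap (fun l m => Q l)).
  exact: (swap (fun l m => Q l *m Q m)).
have GE : G *m G = G + H.
  rewrite {1}/G mulmx_suml {2}/G -big_split; apply: eq_bigr => l pl /=.
  rewrite mulmx_sumr (bigID (fun m => c l != c m)) /= addrC; congr (_ + _).
  rewrite (bigD1 l) /=; last by rewrite pl eqxx.
  rewrite big1 ?addr0; first by have [_ ->] := projQ l.
  by move=> m /andP[/andP[_ /negPn/eqP clm] ml]; rewrite orthQ // eq_sym.
have pD : psd (K%:R *: G - D).
  rewrite scaler_sumr -sumrB; apply: psd_sum => l pl.
  rewrite sumr_const -[X in _ - X]scaler_nat -scalerBl; apply: psdZ; last exact: is_proj_psd.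
  rewrite subr_ge0 ler_nat (leq_trans _ (degK l)) //; apply: subset_leq_card.
  by apply/subsetP => m; rewrite !inE eq_sym => /andP[].
have -> : 2%:R *: (G *m G) - G = X + (s + s) *: (K%:R *: G - D).
  have sK : (s + s) * K%:R = 1.
    by rewrite -mulr2n -(mulr_natr s 2) -mulrA -natrM mulVf // pnatr_eq0 -lt0n muln_gt0.
  rewrite scalerBr scalerA sK scale1r GE XE [s *: (D + D)]scalerDr -scalerDl.
  move: (G) (H) (_ *: D) => Z W Y; rewrite scaler_nat mulr2n -addrA [_ - Z]addrC addKr.
  by rewrite [RHS]addrC addrA subrK -addrA.
by apply: psdD => //; apply: psdZ => //; rewrite addr_ge0 // ltW.
Qed.

End Gram.

(** Write P_m = (P_m - Q_m) + Q_m. The removed part costs at most its trace, whence 4K^2; the kept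
    part costs its overlap with the earlier ranges, whence 2. *)
Lemma gram_schmidt_povm : exists E : 'I_N -> 'M[C]_n,
  [/\ forall m, psd (E m), psd (1%:M - \sum_m E m)
    & forall m : 'I_N, \tr (P m *m (1%:M - E m)) <=
        (4 * K ^ 2 + 2)%:R * \sum_(l : 'I_N | (l < m)%N && (c l != c m)) \tr (P m *m P l)].
Proof.
have s2_gt0 : 0 < s ^+ 2 by rewrite exprn_gt0.
have [Q hQ] := pruned_projectors s2_gt0.
have pQ m : is_proj (Q m) by have [] := hQ m.
have PQ m : P m *m Q m = Q m by have [] := hQ m.
have QP m : Q m *m P m = Q m.
  by have [[hP _] [hm _]] := (projP m, pQ m); rewrite -hP -[in LHS]hm -adjmxM PQ.
have orthQ (l m : 'I_N) : l != m -> c l = c m -> Q l *m Q m = 0.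
  move=> lm clm; rewrite -(QP l) -(PQ m) mulmxA -(mulmxA (Q l)).
  by rewrite orthP // mulmx0 mul0mx.
have subQ m : psd (P m - Q m) by apply/is_proj_psd/is_proj_sub.
(* The pruning bounds [Q m *m S *m Q m] for the whole sum; dropping the other positive terms leaves
   the bound for a single [Q l]. *)
have crossQ (l m : 'I_N) : (l < m)%N -> c l != c m ->
    psd (s ^+ 2 *: Q m - Q m *m Q l *m Q m).
  move=> lm clm; have [_ _ + _] := hQ m.
  rewrite /= (bigD1 l) ?lm //=; set S := \sum_(_ | _) _ => pS.
  have {pS} := psdD pS (psd_conj (Q m) (_ : psd S)).
  have [-> _] := pQ m; rewrite mulmxDr mulmxDl opprD addrA subrK; apply.
  by apply: psd_sum => j _; exact: is_proj_psd.
pose G k := \sum_(l : 'I_N | (l < k)%N) Q l.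
have pG k : psd (G k) by apply: psd_sum => l _; exact: is_proj_psd.
pose U k := suppmx (G k).
have pU k : is_proj (U k) by exact: suppmx_is_proj.
(* 1 - U_k kills G_k, hence by [psd_sum_ker] each of its summands. *)
have UQ k (l : 'I_N) : (l < k)%N -> U k *m Q l = Q l.
  move=> lk; apply/eqP; rewrite eq_sym -subr_eq0 -{1}[Q l]mul1mx -mulmxBl; apply/eqP.
  apply: (@psd_sum_ker _ [pred l : 'I_N | (l < k)%N] Q) => //=.
  by rewrite -/(G k) mulmxBl mul1mx suppmx_mul // subrr.
have UU k k' : (k <= k')%N -> U k' *m U k = U k.
  move=> kk'; have [B EB] := suppmx_range (pG k).
  rewrite /U EB mulmxA; congr (_ *m _); rewrite mulmx_sumr; apply: eq_bigr => l lk.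
  exact/UQ/(leq_trans lk).
(* [G m] stops before [m], so [E m] projects onto what [Q m] adds to the earlier ranges. *)
pose E (m : 'I_N) := U m.+1 - U m.
have pE m : is_proj (E m) by apply: is_proj_sub => //; exact: UU.
exists E; split=> [m||m]; first exact: is_proj_psd.
  (* After telescoping, the deficit is (1 - U_N) + U_0, a sum of two projectors. *)
  have -> : \sum_m E m = U N - U 0%N.
    by rewrite -telescope_sumr // big_mkord.
  rewrite opprB addrCA addrC; apply: psdD; apply: is_proj_psd => //.
  apply: is_proj_sub; rewrite ?mul1mx //.
  by split; [exact: adjmx1 | exact: mul1mx].
set t := \sum_(l | _) _.
have ht : \sum_(l : 'I_N | (l < m)%N && (c l != c m)) \tr (P m *m Q l) <= t.
  by apply: ler_sum => l _; exact: psd_trace_proj_le.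
have ht' : \sum_(l : 'I_N | (l < m)%N && (c l != c m)) \tr (Q m *m Q l) <= t.
  apply: le_trans ht; apply: ler_sum => l _.
  by rewrite [leLHS]mxtrace_mulC [leRHS]mxtrace_mulC; exact: psd_trace_proj_le.
have h1 : \tr ((P m - Q m) *m (1%:M - E m)) <= (4 * K ^ 2)%:R * t.
  have h : s ^+ 2 * \tr (P m - Q m) <= t.
    have [_ _ _ /le_trans] := hQ m; apply.
    by rewrite mulmx_sumr linear_sum.
  apply: (@le_trans _ _ (\tr (P m - Q m))).
    rewrite -[X in _ <= \tr X]mulmx1; apply: psd_trace_proj_le; last exact: is_proj_sub.
    by rewrite opprB addrC subrK; exact: is_proj_psd.
  have sE : s ^+ 2 = (4 * K ^ 2)%:R^-1 by rewrite /s exprVn -natrX expnMn.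
  by move: h s2_gt0; rewrite sE invr_gt0 mulrC => h ?; rewrite -ler_pdivrMl // mulrC.
have h2 : \tr (Q m *m (1%:M - E m)) <= 2%:R * t.
  (* As Q_m <= U_(m+1), the loss is exactly the overlap of [Q m] with [U m]. *)
  have QU : Q m *m U m.+1 = Q m.
    have [[hU _] [hm _]] := (pU m.+1, pQ m).
    by rewrite -hU -[in LHS]hm -adjmxM UQ.
  have -> : Q m *m (1%:M - E m) = Q m *m U m.
    by rewrite /E !mulmxBr mulmx1 QU opprB addrC subrK.
  have gap := @gram_gap Q pQ orthQ crossQ (fun l => (l < m)%N).
  apply: le_trans (psd_trace_proj_le (suppmx_le (pG m) gap) (pQ m)) _.
  rewrite -scalemxAr linearZ ler_pM2l ?ltr0n //=; apply: le_trans ht'.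
  (* Earlier projectors with the same label are orthogonal to [Q m] and drop out. *)
  rewrite mulmx_sumr linear_sum /= (bigID (fun l => c l != c m)) /=.
  rewrite [X in _ + X]big1 ?addr0 // => l /andP[lm /negPn/eqP clm].
  by rewrite orthQ ?linear0 // eq_sym neq_ltn lm.
rewrite -{1}(subrK (Q m) (P m)) mulmxDl linearD natrD mulrDl /=.
exact: lerD.
Qed.
End Core.

(** Outcome i collects the [E m] labelled i, and the deficit [Z] goes to outcome 0. The [M i] are
    positive with sum 1, so each is at most 1. *)
Lemma coarse_povm (r N : nat) (E : 'I_N -> 'M[C]_n) (c : 'I_N -> 'I_r) :
  (0 < r)%N -> (forall m, psd (E m)) -> psd (1%:M - \sum_m E m) ->
  exists M : 'I_r -> 'M[C]_n, [/\ forall i, psd (M i), forall i, psd (1%:M - M i),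
    \sum_i M i = 1%:M & forall m, psd (M (c m) - E m)].
Proof.
move=> r0 pE pZ; set Z := 1%:M - _ in pZ.
pose M i := \sum_(m | c m == i) E m + (i == Ordinal r0)%:R *: Z.
have pZb (b : bool) : psd (b%:R *: Z) by exact: psdZ.
have pM i : psd (M i) by apply: psdD => //; exact: psd_sum.
have sM : \sum_i M i = 1%:M.
  rewrite big_split -scaler_suml /=.
  have <- : \sum_m E m = \sum_i \sum_(m | c m == i) E m.
    by rewrite (partition_big c predT).
  by rewrite -natr_sum -big_mkcond big_pred1_eq scale1r addrC subrK.
exists M; split=> // [i|m].
  by rewrite -sM (bigD1 i) //= addrAC subrr add0r; apply: psd_sum.
rewrite /M (bigD1 m) //= addrAC [E m + _ - _]addrAC subrr add0r.
by apply: psdD => //; exact: psd_sum.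
Qed.

End Square.
End Psd.

(** Irreflexivity excludes the diagonal, and exchanging the indices maps the terms l < m onto the
    terms m < l. *)
Lemma sum_lt_sym (V : nmodType) (N : nat) (q : rel 'I_N) (g : 'I_N -> 'I_N -> V) :
  irreflexive q -> symmetric q -> (forall l m, g l m = g m l) ->
  \sum_m \sum_(l | q l m) g l m =
  (\sum_(m : 'I_N) \sum_(l : 'I_N | (l < m)%N && q l m) g l m) *+ 2.
Proof.
move=> qI qS gS; rewrite mulr2n.
have -> : \sum_m \sum_(l | q l m) g l m =
    \sum_(m : 'I_N) \sum_(l : 'I_N | (l < m)%N && q l m) g l m +
    \sum_(m : 'I_N) \sum_(l : 'I_N | (m < l)%N && q l m) g l m.
  rewrite -big_split; apply: eq_bigr => m _ /=.
  rewrite (bigID (fun l : 'I_N => (l < m)%N)) /=; congr (_ + _); apply: eq_bigl => l.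
    by rewrite andbC.
  case: ltngtP => [||/val_inj ->]; rewrite ?andbT ?andbF //.
congr (_ + _); rewrite (exchange_big_dep predT) //=; apply: eq_bigr => m _.
by apply: eq_big => [l|l _]; rewrite ?(qS m) // gS.
Qed.

(** * Eigenvalues and eigenprojectors of the given operators *)

Section Spectral.
Local Open Scope sesquilinear_scope.
Variables (R : realType) (n : nat).
Implicit Type A : 'M[R[i]]_n.

Lemma psdmxE A : psdmx A <-> psd A.
Proof.
split=> -[hA p]; split=> //; last by apply/is_hermitianmxP; rewrite expr0 scale1r hA.
by move/is_hermitianmxP: hA; rewrite expr0 scale1r => {2}->.
Qed.

Section Decomposition.
Variables (A : 'M[R[i]]_n) (T : nat) (lam : 'I_T -> R) (Q : 'I_T -> 'M[R[i]]_n).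
Hypothesis decA : is_spectral_decomposition A lam Q.
Hypothesis psdA : psd A.

Lemma spectral_is_proj k : is_proj (Q k).
Proof.
have [_ _ /(_ k)[/is_hermitianmxP hQ QQ _] _] := decA; split=> //.
by move: hQ; rewrite expr0 scale1r => {2}->.
Qed.

Lemma spectral_mull k : Q k *m A = (lam k)%:C *: Q k.
Proof.
have [_ _ /(_ k)[_ _ QE] _] := decA.
by apply/eigenspaceP; rewrite -QE.
Qed.

Lemma spectral_mulr k : A *m Q k = (lam k)%:C *: Q k.
Proof.
have [[hA _] [hQ _]] := (psdA, spectral_is_proj k).
rewrite -hA -[in LHS]hQ -adjmxM spectral_mull adjmxZ hQ.
by congr (_ *: _); apply/CrealP/complex_realP; exists (lam k).
Qed.

(** Q_k A Q_l is evaluated from both sides; distinct eigenvalues force Q_k Q_l = 0. *)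
Lemma spectral_orth k l : k != l -> Q k *m Q l = 0.
Proof.
move=> kl; have [inj _ _ _] := decA.
have : (lam k)%:C *: (Q k *m Q l) = (lam l)%:C *: (Q k *m Q l).
  by rewrite scalemxAl -spectral_mull -mulmxA spectral_mulr -scalemxAr.
move/eqP; rewrite -subr_eq0 -scalerBl scaler_eq0 subr_eq0 => /orP[/eqP|/eqP//].
by move/complexI/inj => E; rewrite E eqxx in kl.
Qed.

Lemma spectral_ge0 k : 0 <= lam k.
Proof.
have [_ /(_ (lam k)%:C) [_ h] _ _] := decA.
have /eigenvalueP[v vA v0] := h (ex_intro _ k erefl).
have [_ /(_ v)] := psdA; rewrite vA -scalemxAl mxE -trace_mx11.
rewrite pmulr_lge0; first by rewrite ler0c.
rewrite lt_neqAle mxtrace_gram_ge0 andbT eq_sym; apply: contra v0 => /eqP h0.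
by apply/eqP/mxtrace_gram_eq0.
Qed.

End Decomposition.
End Spectral.

(** * Sorting the projectors and reindexing sums over pairs *)

Lemma sort_bij (R : realType) (I : finType) (mu : I -> R) :
  exists (N : nat) (o : 'I_N -> I), bijective o /\
    (forall l m : 'I_N, (l < m)%N -> mu (o m) <= mu (o l)).
Proof.
pose ge x y := mu y <= mu x.
pose t := sort_tuple ge (enum_tuple I).
exists #|I|, (tnth t); split.
  apply: inj_card_bij; last by rewrite card_ord.
  by apply/tuple_uniqP; rewrite sort_uniq enum_uniq.
move=> l m lm; have x0 := tnth t l; rewrite !(tnth_nth x0).
have ge_tr : transitive ge by move=> y x z h1 h2; exact: le_trans h2 h1.
have sz : size (sort ge (enum I)) = #|I| by rewrite size_sort -cardE.
apply: (sorted_ltn_nth ge_tr) => //; rewrite ?inE ?sz ?ltn_ord //.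
by apply: sort_sorted => x y; exact: le_total.
Qed.

(** Each of the r - 1 other labels carries at most T indices; this is the source of K = (r - 1)T. *)
Lemma card_tagged_neq (r : nat) (T : 'I_r -> nat) (i : 'I_r) :
  (#|[pred x : {i : 'I_r & 'I_(T i)} | tag x != i]| <= r.-1 * \max_(i < r) T i)%N.
Proof.
rewrite (_ : #|_| = \sum_(j | j != i) \sum_(k < T j) 1)%N; last first.
  by rewrite sig_big_dep -sum1_card; apply: eq_bigl => x; rewrite inE andbT.
apply: (@leq_trans (\sum_(j | j != i) \max_(i < r) T i)%N).
  by apply: leq_sum => j _; rewrite sum1_card card_ord; exact: leq_bigmax.
by rewrite sum_nat_const cardC1 card_ord.
Qed.

(** One side orders pairs by position in the list, the other by label. Doubled, both become the sum
    over all ordered pairs with different labels. *)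
Lemma sum_tagged_pairs (V : numDomainType) (r N : nat) (T : 'I_r -> nat)
    (o : 'I_N -> {i : 'I_r & 'I_(T i)})
    (g : {i : 'I_r & 'I_(T i)} -> {i : 'I_r & 'I_(T i)} -> V) :
  bijective o -> (forall x y, g x y = g y x) ->
  \sum_(m : 'I_N) \sum_(l : 'I_N | (l < m)%N && (tag (o l) != tag (o m))) g (o l) (o m) =
  \sum_(i < r) \sum_(j < r | (i < j)%N) \sum_(k < T i) \sum_(l < T j)
    g (Tagged (fun i => 'I_(T i)) k) (Tagged (fun i => 'I_(T i)) l).
Proof.
move=> o_bij gC; pose tg (i : 'I_r) (k : 'I_(T i)) := Tagged (fun i => 'I_(T i)) k.
pose F (i j : 'I_r) := \sum_(k < T i) \sum_(l < T j) g (tg i k) (tg j l).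
have FC i j : F i j = F j i.
  rewrite /F exchange_big; apply: eq_bigr => k _; apply: eq_bigr => l _; exact: gC.
transitivity (\sum_(j : 'I_r) \sum_(i : 'I_r | (i < j)%N && (i != j)) F i j); last first.
  rewrite [RHS](exchange_big_dep predT) //=; apply: eq_bigr => j _.
  by apply: eq_bigl => i; rewrite neq_ltn; case: ltnP.
pose q : rel 'I_N := fun l m => tag (o l) != tag (o m).
have qI : irreflexive q by move=> l; rewrite /q eqxx.
have qS : symmetric q by move=> l m; rewrite /q eq_sym.
(* The equation is recast as a disjunction whose first member computes to false, the form from which
   both sides can be multiplied by 2. *)
apply/eqP; rewrite -[_ == _]/((2 == 0)%N || _) -eqrMn2r.
rewrite -(sum_lt_sym qI qS (fun l m => gC (o l) (o m))).
rewrite -(@sum_lt_sym _ _ (fun i j => i != j)) //; last first.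
- by move=> i j; rewrite eq_sym.
- by move=> i; rewrite eqxx.
apply/eqP; transitivity (\sum_x \sum_(y | tag y != tag x) g y x).
  rewrite [RHS](reindex o) /=; last exact: onW_bij.
  by apply: eq_bigr => m _; rewrite [RHS](reindex o) //=; exact: onW_bij.
transitivity (\sum_j \sum_(l < T j) \sum_(y | tag y != j) g y (tg j l)).
  by rewrite [RHS]sig_big_dep /=; apply: eq_bigr => -[].
apply: eq_bigr => j _.
transitivity (\sum_(l < T j) \sum_(i | i != j) \sum_k g (tg i k) (tg j l)).
  apply: eq_bigr => l _; rewrite sig_big_dep /=.
  by apply: eq_big => [x|[]//]; rewrite andbT.
by rewrite exchange_big /=; apply: eq_bigr => i _; exact: exchange_big.
Qed.

(** * The bound on the minimal error *)

Theorem theorem2 (R : realType) :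
  exists f : nat -> nat -> R,
    (forall r T : nat, (2 <= r)%N -> (1 <= T)%N ->
       f r T < 10%:R * (r%:R - 1) ^+ 2 * T%:R ^+ 2) /\
    (forall (n r : nat) (A : 'I_r -> 'M[R[i]]_n) (T : 'I_r -> nat)
            (lam : forall i : 'I_r, 'I_(T i) -> R)
            (Q : forall i : 'I_r, 'I_(T i) -> 'M[R[i]]_n),
       (2 <= r)%N ->
       (forall i : 'I_r, psdmx (A i)) ->
       (forall i : 'I_r, is_spectral_decomposition (A i) (lam i) (Q i)) ->
       min_error A <=
         f r (\max_(i < r) T i)%N *
         \sum_(i < r) \sum_(j < r | (i < j)%N)
           \sum_(k < T i) \sum_(l < T j)
             Num.min (lam i k) (lam j l) * complex.Re (\tr (Q i k *m Q j l))).
Proof.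
(* maxn T 1 keeps K positive when T = 0, which occurs for n = 0. *)
exists (fun r T => (4 * (r.-1 * maxn T 1) ^ 2 + 2)%:R); split=> [r T r2 T1|].
  have -> : r%:R - 1 = r.-1%:R :> R by rewrite -subn1 natrB // ltnW.
  rewrite (maxn_idPl T1) -mulrA -exprMn -natrM -natrX -natrM ltr_nat.
  (* With x = ((r - 1)T)^2 >= 1, the claim is 4x + 2 < 4x + 6x. *)
  have : (0 < (r.-1 * T) ^ 2)%N by rewrite expn_gt0 muln_gt0 T1 -subn1 subn_gt0 r2.
  by move=> h; rewrite (mulnDl 4 6) ltn_add2l (leq_trans _ (leq_pmulr 6 h)).
move=> n r A T lam Q r2 pA decA; have r0 : (0 < r)%N := ltnW r2.
have psdA i : psd (A i) by apply/psdmxE.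
pose I := {i : 'I_r & 'I_(T i)}.
pose mu (x : I) := lam (tag x) (tagged x).
pose P (x : I) := Q (tag x) (tagged x).
pose tau x y := complex.Re (\tr (P x *m P y)).
have projP x : is_proj (P x) := spectral_is_proj (decA (tag x)) (tagged x).
have tauE x y : \tr (P x *m P y) = (tau x y)%:C.
  by rewrite RRe_real // ger0_real //; apply: psd_trace_proj => //; exact: is_proj_psd.
have tauC x y : tau x y = tau y x by rewrite /tau mxtrace_mulC.
have [N [o [o_bij o_sorted]]] := sort_bij mu.
pose c m := tag (o m).
set K := (r.-1 * maxn _ 1)%N.
have K_gt0 : (0 < K)%N by rewrite muln_gt0 -subn1 subn_gt0 r2 leq_maxr.
have degK m : (#|[pred l | c l != c m]| <= K)%N.
  apply: leq_trans (leq_trans (card_tagged_neq T (c m)) _); last first.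
    by rewrite leq_mul2l leq_maxl orbT.
  rewrite -(card_imset _ (bij_inj o_bij)); apply: subset_leq_card.
  by apply/subsetP => _ /imsetP[l + ->].
have orthP l m : l != m -> c l = c m -> P (o l) *m P (o m) = 0.
  rewrite /c /P -(inj_eq (bij_inj o_bij)).
  (* Eliminating the equality of labels places both projectors in the decomposition of one
     operator. *)
  case: (o l) (o m) => [i k] [j k'] /= ne ij; case: j / ij k' ne => k' ne.
  by apply: spectral_orth => //; apply: contra ne => /eqP ->.
have [E [pE pZ hE]] := gram_schmidt_povm (fun m => projP (o m)) orthP K_gt0 degK.
have [M [pM pM1 sM ME]] := coarse_povm c r0 pE pZ.
have povM : is_povm M.
  split=> [i|]; last exact: sM.
  by rewrite /loewner_le subr0; split; apply/psdmxE; [exact: pM | exact: pM1].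
apply: le_trans ((min_errorP A r0).2 M povM) _.
have mu_ge0 x : 0 <= mu x by exact: (spectral_ge0 (decA (tag x)) (psdA (tag x)) (tagged x)).
pose q : rel 'I_N := fun l m => c l != c m.
(* Each pair occurs once, in sorted order, so the minimum is the eigenvalue at the later index
   [m]. *)
pose B := \sum_(m : 'I_N) \sum_(l : 'I_N | (l < m)%N && q l m)
  Num.min (mu (o l)) (mu (o m)) * tau (o l) (o m).
apply: (@le_trans _ _ ((4 * K ^ 2 + 2)%:R * B)).
  (* The comparison is made in [R[i]], whose order also equates imaginary parts; real parts are
     extracted at the end by [lecE]. *)
  have : \sum_i \tr (A i *m (1%:M - M i)) <= ((4 * K ^ 2 + 2)%:R * B)%:C.
    have -> : \sum_i \tr (A i *m (1%:M - M i)) =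
        \sum_x (mu x)%:C * \tr (P x *m (1%:M - M (tag x))).
      rewrite -(sig_big_dep predT (fun _ _ => true)
        (fun i k => (lam i k)%:C * \tr (Q i k *m (1%:M - M i)))) /=.
      apply: eq_bigr => i _; have [_ _ _ ->] := decA i.
      rewrite mulmx_suml linear_sum; apply: eq_bigr => k _.
      by rewrite -scalemxAl linearZ.
    rewrite (reindex o) /=; last exact: onW_bij.
    rewrite mulr_sumr rmorph_sum; apply: ler_sum => m _.
    rewrite [leRHS](_ : _ = (mu (o m))%:C * ((4 * K ^ 2 + 2)%:R *
         \sum_(l : 'I_N | (l < m)%N && q l m) \tr (P (o m) *m P (o l)))); last first.
      under [in RHS]eq_bigr do rewrite tauE.
      rewrite -rmorph_sum -(rmorph_nat (real_complex R)) -!rmorphM /=.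
      apply: (congr1 (real_complex R)); rewrite mulrCA; congr (_ * _); rewrite mulr_sumr.
      by apply: eq_bigr => l /andP[lm _]; rewrite (min_idPr (o_sorted _ _ lm)) tauC.
    apply: ler_wpM2l; first by rewrite ler0c.
    (* [E m] is below the outcome of its label, so 1 - M <= 1 - E there. *)
    apply: le_trans (psd_trace_proj_le _ (projP (o m))) (hE m).
    by rewrite opprB addrC addrA subrK; exact: ME.
  by rewrite lecE => /andP[].
rewrite ler_wpM2l ?ler0n //.
rewrite /B (sum_tagged_pairs (g := fun x y => Num.min (mu x) (mu y) * tau x y) o_bij) //.
by move=> x y; rewrite minC tauC.
Qed.
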